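(* Let $\mathcal{G}=(V,E)$ be a finite tree with at least three vertices, with boundary $\delta\Omega$ (the set of vertices of degree one), such that $\deg(x)\le D$ for every $x\in V$, where $D$ is a positive integer. Then the first nonzero Steklov eigenvalue $\lambda_2$ of $(\mathcal{G},\delta\Omega)$ satisfies $$\lambda_2\leq \frac{4(D-1)}{|\delta\Omega|}.$$
   Context: Let $\mathcal{G}=(V,E)$ be a finite tree (simple, undirected, unweighted) with at least three vertices. Its boundary $\delta\Omega$ is the set of vertices of degree one and its interior is $\Omega=V\setminus\delta\Omega$; $|\cdot|$ denotes cardinality. The Steklov problem on $(\mathcal{G},\delta\Omega)$ is: for nonzero $f\in\mathbb{R}^V$ and $\lambda\in\mathbb{R}$, $\Delta f(x)=0$ for $x\in\Omega$ and $\frac{\partial f}{\partial n}(x)=\lambda f(x)$ for $x\in\delta\Omega$, where $(\Delta f)(x)=\sum_{y\sim x}(f(x)-f(y))$ and $\frac{\partial f}{\partial n}(x)=\sum_{y\in\Omega,\,y\sim x}(f(x)-f(y))$. The Steklov eigenvalues are the eigenvalues of the Dirichlet-to-Neumann operator on $\mathbb{R}^{\delta\Omega}$, $f\mapsto \frac{\partial\hat f}{\partial n}$, where $\hat f$ is the harmonic extension of $f$ ($\Delta\hat f=0$ on $\Omega$, $\hat f=f$ on $\delta\Omega$). This operator is self-adjoint and non-negative; its eigenvalues, counted with multiplicity, are ordered $0=\lambda_1\le\lambda_2\le\cdots\le\lambda_{|\delta\Omega|}$. *)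

(* Defs.v *)
From mathcomp Require Import all_boot all_order all_algebra.
From mathcomp Require Import classical_sets reals.

Set Implicit Arguments.
Unset Strict Implicit.
Unset Printing Implicit Defensive.

Import Order.TTheory GRing.Theory Num.Theory.
Local Open Scope ring_scope.

(* A finite simple graph is a symmetric irreflexive relation on a finType.
   [::x; y] is a [ucycle] for every edge xy, so only the duplicate-free cyclic
   sequences of size at least 3 are graph cycles. *)
Definition is_tree (V : finType) (e : rel V) : Prop :=
  [/\ symmetric e, irreflexive e, forall x y : V, connect e x y
    & forall c : seq V, ucycle e c -> (size c < 3)%N].

Definition degree (V : finType) (e : rel V) (x : V) : nat := #|[set y | e x y]|.

Definition boundary (V : finType) (e : rel V) : {set V} :=
  [set x | degree e x == 1%N].

Definition interior (V : finType) (e : rel V) : {set V} := ~: boundary e.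

Definition bvertex (V : finType) (e : rel V) := {x : V | x \in boundary e}.

Section Steklov.
Variables (R : realType) (V : finType) (e : rel V).

(* R^o is R seen as a vector space over itself, which makes the spaces of
   functions below finite-dimensional vector spaces over R. *)
Local Notation vfun := {ffun V -> R^o}.
Local Notation bfun := {ffun bvertex e -> R^o}.

Definition laplacian (u : vfun) (x : V) : R := \sum_(y | e x y) (u x - u y).

Definition normal_derivative (u : vfun) (x : V) : R :=
  \sum_(y in interior e | e x y) (u x - u y).

Definition is_harmonic_extension (f : bfun) (u : vfun) : Prop :=
  (forall x : V, x \in interior e -> laplacian u x = 0) /\
  (forall x : bvertex e, u (val x) = f x).

(* The extension exists and is unique when e is a tree with at least three vertices. *)
Definition harmonic_extension (f : bfun) : vfun :=
  xget 0 [set u | is_harmonic_extension f u]%classic.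

Definition DtN_fun (f : bfun) : bfun :=
  [ffun x => normal_derivative (harmonic_extension f) (val x)].

Definition DtN : 'End(bfun) := linfun DtN_fun.

(* s lists the eigenvalues of the Dirichlet-to-Neumann operator in
   nondecreasing order, each repeated as often as its eigenspace has
   dimensions. Numbering starts from 0: the eigenvalue lambda_k is s`_(k - 1). *)
Definition steklov_spectrum (s : seq R) : Prop :=
  [/\ size s = #|boundary e|, sorted <=%R s
    & forall a : R, count_mem a s = \dim (passmx.leigenspace DtN a)].

Lemma steklov_spectrum_unique (s t : seq R) :
  steklov_spectrum s -> steklov_spectrum t -> s = t.
Proof.
move=> [_ s_sorted s_mult] [_ t_sorted t_mult].
apply: (sorted_eq le_trans le_anti s_sorted t_sorted).
by apply/allP => a _ /=; rewrite s_mult t_mult.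
Qed.

End Steklov.

(* Main.v *)
From HB Require Import structures.
Require Import Defs.
From mathcomp Require Import all_boot all_order all_algebra.
From mathcomp Require Import reals.
From mathcomp Require Import spectral sesquilinear complex.
From mathcomp Require Import zify ring lra.

(** The bound comes from cutting the tree at one well-chosen edge.

    Removing an edge xy of a tree splits the vertices into two sides. Let b be
    the number of leaves of the tree and a the number of leaves on the side of
    y. The function v equal to b - a on that side and to - a on the other one
    varies along the edge xy only, hence has Dirichlet energy b^2. Its
    restriction g to the leaves has sum 0 and squared norm a b (b - a). Among
    all functions with given values on the leaves the harmonic extension has
    the least energy, and the energy of the harmonic extension of g is
    <DtN g, g>; so the Rayleigh quotient of g is at most b / (a (b - a)).
    As g is orthogonal to the constants, on which the self-adjoint operator DtN
    vanishes, this quotient bounds the second eigenvalue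
    ([spectrum_edge_bound]).

    It remains to find an edge for which a (b - a) is large. The tree has an
    interior vertex x none of whose branches carries more than half of the
    leaves ([exists_centroid]): walk from any interior vertex towards the
    branch with too many leaves until there is no such branch. The branches at
    x number at most D and share all b leaves, so one of them has at least b / D
    and at most b / 2 leaves ([exists_balanced_edge]). For the edge leading to
    it, b <= D a <= 2 (D - 1) a, as D >= 2, and b <= 2 (b - a), which gives
    b^2 <= 4 (D - 1) a (b - a).

    The spectrum itself is obtained from the spectral theorem for Hermitian
    matrices, applied to the complexification of the real symmetric matrix of
    DtN ([symmetric_spectrum], [selfadjoint_spectrum]). *)

Set Implicit Arguments.
Unset Strict Implicit.
Unset Printing Implicit Defensive.

Import passmx Order.TTheory GRing.Theory Num.Theory.
Local Open Scope ring_scope.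

(** * Sides of an edge in a tree, and balanced edges *)

Definition avoiding (V : finType) (e : rel V) (x : V) : rel V :=
  [rel u v | [&& e u v, u != x & v != x]].

(** The component of y in the graph without x. In a tree with edge xy it is also
    the component of y once that edge is removed; deleting the vertex makes it
    immediate that x lies outside. *)
Definition side (V : finType) (e : rel V) (x y : V) : {set V} :=
  [set w | connect (avoiding e x) y w].

Definition leaves (V : finType) (e : rel V) (x y : V) : {set V} :=
  side e x y :&: boundary e.

Section Tree.
Variables (V : finType) (e : rel V).
Hypothesis e_tree : is_tree e.

Let e_sym : symmetric e. Proof. by case: e_tree. Qed.
Let e_irr : irreflexive e. Proof. by case: e_tree. Qed.
Let e_conn x y : connect e x y. Proof. by case: e_tree. Qed.

Lemma edge_neq x y : e x y -> y != x.
Proof. by apply: contraTneq => ->; rewrite e_irr. Qed.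

Lemma mem_side x y : y \in side e x y.
Proof. by rewrite inE. Qed.

Lemma side_neq x y w : e x y -> w \in side e x y -> w != x.
Proof.
move=> exy; rewrite inE => /(@closed_connect _ _ (predC1 x)).
rewrite !inE edge_neq // => <- // u v /= /and3P[_ ux vx].
by rewrite !inE ux vx.
Qed.

Lemma notin_side x y : e x y -> x \notin side e x y.
Proof. by move=> exy; apply/negP => /(side_neq exy); rewrite eqxx. Qed.

(** This is where acyclicity enters: a second edge from x into the side of y
    would close a cycle through x, y and a path inside that side. *)
Lemma side_exit x y u v : e x y -> e u v ->
  u \in side e x y -> v \notin side e x y -> u = y /\ v = x.
Proof.
move=> exy euv u_in v_out.
have vx : v = x.
  apply/eqP; apply: contraNT v_out => vx; move: (u_in); rewrite !inE => yu.
  apply: connect_trans yu (connect1 _).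
  by rewrite /avoiding /= euv vx (side_neq exy u_in).
split=> //; apply/eqP; apply: contraT => uy.
move: u_in; rewrite inE => /connectP[p p_path p_last].
case/shortenP: p_path p_last => q q_path q_uniq _ q_last.
have q_e : path e y q by apply: sub_path q_path => ? ? /and3P[].
have q_x : all (predC1 x) (y :: q).
  rewrite /= edge_neq //=; elim: q (y) q_path {q_uniq q_last q_e} => //= z q IH t.
  by case/andP=> /and3P[_ _ ->] /IH.
have cyc : ucycle e [:: x, y & q].
  rewrite /ucycle /= rcons_path q_e exy -q_last -{1}vx euv /=.
  move: q_uniq => /= ->; rewrite andbT.
  by apply/negP => /(allP q_x); rewrite /= eqxx.
case: e_tree => _ _ _ /(_ _ cyc) /=.
by case: q q_last {q_path q_uniq q_e q_x cyc} => //= E; rewrite E eqxx in uy.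
Qed.

(** The only edge leaving a side has y as an endpoint, so walks that avoid y never
    cross from one side to the other. *)
Lemma side_closed x y : e x y -> closed (avoiding e y) (side e x y).
Proof.
move=> exy u v /and3P[euv uy vy].
have stays a b : e a b -> a != y -> a \in side e x y -> b \in side e x y.
  move=> eab ay a_in; apply: contraT => b_out.
  by case: (side_exit exy eab a_in b_out) ay => ->; rewrite eqxx.
by apply/idP/idP; apply: stays; rewrite // e_sym.
Qed.

Lemma sub_side x y z : e x y -> e y z -> z != x -> side e y z \subset side e x y.
Proof.
move=> exy eyz zx; apply/subsetP => w; rewrite [w \in side e y z]inE.
have /closed_connect cl := side_closed exy.
move/cl => <-; apply: contraT => z_out.
by case: (side_exit exy eyz (mem_side x y) z_out) zx => _ ->; rewrite eqxx.
Qed.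

(** Sides shrink when one walks away from x, which makes their cardinality a
    termination measure for walks in the tree. *)
Lemma proper_side x y z : e x y -> e y z -> z != x -> side e y z \proper side e x y.
Proof.
move=> exy eyz zx; rewrite properE sub_side //=; apply/subsetPn.
by exists y; rewrite ?mem_side ?notin_side.
Qed.

Lemma disjoint_sides x y : e x y -> [disjoint side e x y & side e y x].
Proof.
move=> exy; rewrite disjoint_sym disjoints_subset; apply/subsetP => w.
rewrite in_setC [w \in side e y x]inE.
have /closed_connect cl := side_closed exy.
by move/cl => <-; exact: notin_side.
Qed.

Lemma side_cover x w : w != x -> exists2 y, e x y & w \in side e x y.
Proof.
move=> wx; have /connectP[p p_path p_last] := e_conn x w.
case/shortenP: p_path p_last => q q_path q_uniq _ q_last.
case: q q_path q_uniq q_last => [|y q] /=; first by move=> _ _ /eqP; rewrite (negPf wx).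
case/andP=> exy q_path /andP[x_out _] ->.
exists y => //; rewrite inE; apply/connectP; exists q => //.
elim: q y q_path x_out {exy} => //= z q IH y /andP[eyz q_path].
rewrite !inE !negb_or => /and3P[xy xz xq].
by rewrite /avoiding /= eyz eq_sym xy eq_sym xz /= IH // inE negb_or xz.
Qed.

Lemma neighbour_neq x y : e x y -> y \notin boundary e -> exists2 z, e y z & z != x.
Proof.
rewrite inE /degree e_sym => eyx.
rewrite (cardsD1 x) inE eyx -[1%N]addn0 eqn_add2l cards_eq0 => /set0Pn[z].
by rewrite !inE => /andP[zx eyz]; exists z.
Qed.

Lemma leaf_neighbour x y z : x \in boundary e -> e x y -> e x z -> y = z.
Proof.
rewrite inE => /cards1P[t tP] exy exz.
have: y \in [set y | e x y] by rewrite inE.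
have: z \in [set y | e x y] by rewrite inE.
by rewrite tP !inE => /eqP-> /eqP->.
Qed.

(** Walking away from x, one meets smaller and smaller sides and must stop, which
    happens only at a leaf. *)
Lemma side_has_leaf x y : e x y -> exists w, w \in leaves e x y.
Proof.
have [n] := ubnP #|side e x y|; elim: n x y => // n IH x y lt_n exy.
have [y_leaf|y_int] := boolP (y \in boundary e).
  by exists y; rewrite inE mem_side.
have [z eyz zx] := neighbour_neq exy y_int.
have [|w] := IH y z _ eyz.
  by apply: leq_trans (proper_card (proper_side exy eyz zx)) _.
by rewrite inE => /andP[w_in w_leaf]; exists w;
  rewrite inE w_leaf (subsetP (sub_side exy eyz zx)).
Qed.

Lemma leaf_side x y : e x y -> y \in boundary e -> side e x y = [set y].
Proof.
move=> exy y_leaf; apply/setP => w; rewrite !inE; apply/idP/eqP => [|-> //].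
have cl : closed (avoiding e x) (pred1 y).
  move=> u v /and3P[euv ux vx]; rewrite !inE.
  rewrite e_sym in exy.
  apply/eqP/eqP => E; subst.
    by move: vx; rewrite (leaf_neighbour y_leaf euv exy) eqxx.
  rewrite e_sym in euv.
  by move: ux; rewrite (leaf_neighbour y_leaf euv exy) eqxx.
by move/(closed_connect cl); rewrite !inE eqxx => /esym/eqP.
Qed.

Lemma card_leaves_opposite x y : e x y ->
  (#|leaves e x y| + #|leaves e y x| <= #|boundary e|)%N.
Proof.
move=> exy; rewrite -cardsUI.
rewrite [X in (_ + X)%N](_ : _ = 0%N) ?addn0; last first.
  apply/eqP; rewrite cards_eq0 -subset0; apply/subsetP => w; rewrite !inE.
  case/andP=> /andP[wx _] /andP[wy _].
  have := disjoint_sides exy; rewrite disjoint_subset => /subsetP/(_ w).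
  by rewrite !inE wx wy => /(_ isT).
by apply: subset_leq_card; rewrite subUset !subsetIr.
Qed.

Hypothesis V_ge3 : (3 <= #|V|)%N.

Lemma exists_neighbour x : exists y, e x y.
Proof.
have /card_gt0P[w] : (0 < #|predC1 x|)%N.
  by have := cardC1 x => ->; lia.
by rewrite inE => /side_cover[y exy _]; exists y.
Qed.

(** Two adjacent leaves would form a component, hence a tree, on two vertices. *)
Lemma leaf_neighbour_interior x y : x \in boundary e -> e x y -> y \in interior e.
Proof.
move=> x_leaf exy; rewrite inE; apply/negP => y_leaf.
have cover w : w \in [set x; y].
  have [->|wx] := eqVneq w x; first by rewrite !inE eqxx.
  have [z exz] := side_cover wx.
  rewrite -(leaf_neighbour x_leaf exy exz) leaf_side // !inE => ->.
  by rewrite orbT.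
have: (#|V| <= #|[set x; y]|)%N.
  by apply: subset_leq_card; apply/subsetP => w _; exact: cover.
by rewrite cards2; lia.
Qed.

Lemma exists_interior : exists x, x \in interior e.
Proof.
have /card_gt0P[x _] : (0 < #|V|)%N by lia.
have [x_leaf|x_int] := boolP (x \in boundary e); last by exists x; rewrite inE.
have [y exy] := exists_neighbour x.
by exists y; apply: leaf_neighbour_interior exy.
Qed.

Lemma interior_degree x : x \in interior e -> (2 <= degree e x)%N.
Proof.
rewrite !inE; have [y exy] := exists_neighbour x.
have: (0 < degree e x)%N by apply/card_gt0P; exists y; rewrite inE.
by case: degree => [|[|]].
Qed.

Lemma boundary_ge2 : (2 <= #|boundary e|)%N.
Proof.
have [x _] := exists_interior; have [y exy] := exists_neighbour x.
have eyx : e y x by rewrite e_sym.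
have [u u_in] := side_has_leaf exy; have [v v_in] := side_has_leaf eyx.
apply: leq_trans (card_leaves_opposite exy).
by apply: (@leq_add 1 1); apply/card_gt0P; [exists u | exists v].
Qed.

(** From an interior vertex, walk into the branch that has more than half of the
    leaves, as long as there is one. The walk never turns back, because the
    part it comes from has fewer than half of the leaves; so the sides shrink
    and it stops. It does not stop at a leaf, because the side of a leaf is a
    single vertex and there are at least two leaves. *)
Lemma exists_centroid : exists2 y, y \in interior e &
  forall z, e y z -> (2 * #|leaves e y z| <= #|boundary e|)%N.
Proof.
have step x y : e x y -> (#|boundary e| < 2 * #|leaves e x y|)%N ->
    exists2 y, y \in interior e &
    forall z, e y z -> (2 * #|leaves e y z| <= #|boundary e|)%N.
  have [n] := ubnP #|side e x y|; elim: n x y => // n IH x y lt_n exy big_xy.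
  have y_int : y \in interior e.
    rewrite inE; apply/negP => y_leaf; move: big_xy.
    rewrite /leaves leaf_side //; have := boundary_ge2.
    have := subset_leq_card (subsetIl [set y] (boundary e)); rewrite cards1.
    lia.
  have [/existsP[z /andP[eyz big_yz]]|none] :=
    boolP [exists z, e y z && (#|boundary e| < 2 * #|leaves e y z|)%N]; last first.
    exists y => // z eyz; rewrite leqNgt; apply: contra none => big_yz.
    by apply/existsP; exists z; rewrite eyz.
  have [zx|zx] := eqVneq z x.
    by move: (card_leaves_opposite exy) big_xy big_yz; rewrite zx; lia.
  apply: (IH y z) => //.
  exact: leq_trans (proper_card (proper_side exy eyz zx)) _.
have [y y_int] := exists_interior.
have [/existsP[z /andP[eyz /(step y z eyz)]]|none] :=
    boolP [exists z, e y z && (#|boundary e| < 2 * #|leaves e y z|)%N] => //.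
exists y => // z eyz; rewrite leqNgt; apply: contra none => big_yz.
by apply/existsP; exists z; rewrite eyz.
Qed.

(** The branches at a centroid number at most D and cover all leaves, so an
    average one already has the required number of leaves. *)
Lemma exists_balanced_edge (D : nat) : (forall x, (degree e x <= D)%N) ->
  exists x y, [/\ e x y, (2 * #|leaves e x y| <= #|boundary e|)%N
                & (#|boundary e| <= D * #|leaves e x y|)%N].
Proof.
move=> deg_le; have [y y_int small] := exists_centroid.
have [/existsP[z /andP[eyz big_yz]]|none] :=
  boolP [exists z, e y z && (#|boundary e| <= D * #|leaves e y z|)%N].
  by exists y, z; split=> //; apply: small.
have cover : (#|boundary e| <= \sum_(z in [set z | e y z]) #|leaves e y z|)%N.
  have /subset_leq_card : boundary e \subset \bigcup_(z in [set z | e y z]) leaves e y z.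
    apply/subsetP => w w_leaf.
    have [|z eyz w_in] := @side_cover y w.
      by apply: contraTneq w_leaf => ->; rewrite inE in y_int.
    by apply/bigcupP; exists z; rewrite ?in_setI ?w_in // inE.
  move/leq_trans; apply.
  elim/big_rec2: _ => [|z U n _ IH]; first by rewrite cards0.
  by apply: leq_trans (leq_card_setU _ _) _; rewrite leq_add2l.
have : (D * #|boundary e| <= D * #|boundary e|.-1)%N.
  apply: leq_trans (leq_mul (leqnn D) cover) _; rewrite big_distrr /=.
  apply: (@leq_trans (\sum_(z in [set z | e y z]) #|boundary e|.-1)%N).
    apply: leq_sum => z; rewrite inE => eyz.
    suff: (D * #|leaves e y z| < #|boundary e|)%N by lia.
    by rewrite ltnNge; apply: contra none => ?; apply/existsP; exists z; rewrite eyz.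
  by rewrite sum_nat_const leq_mul2r deg_le orbT.
have D_ge2 := leq_trans (interior_degree y_int) (deg_le y).
rewrite leq_pmul2l; last by lia.
by have := boundary_ge2; lia.
Qed.

End Tree.

(** * Spectrum of a real symmetric matrix *)

(** Selecting the rows and columns of the nonzero entries and rescaling turns the
    diagonal matrix into an identity matrix. *)
Lemma leq_rank_diag_mx (F : fieldType) n (d : 'rV[F]_n) :
  (#|[set i | (d 0 i != 0)%R]| <= \rank (diag_mx d))%N.
Proof.
set k := #|_|; pose E : 'M[F]_(k, n) := \matrix_(i, j) (enum_val i == j)%:R.
pose c : 'rV[F]_n := \row_i (d 0 i)^-1.
have EdE : E *m diag_mx d *m (diag_mx c *m E^T) = 1%:M.
  apply/matrixP => i j; rewrite mul_mx_diag mul_diag_mx !mxE.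
  rewrite (bigD1 (enum_val i)) //= !mxE eqxx mul1r big1 => [|l li].
    rewrite addr0 mulrA divff; last by have := enum_valP i; rewrite inE.
    by rewrite mul1r (inj_eq enum_val_inj) eq_sym.
  by rewrite !mxE eq_sym (negPf li) !mul0r.
rewrite -{1}(mxrank1 F k) -EdE.
exact: leq_trans (mxrankM_maxl _ _) (mxrankM_maxr _ _).
Qed.

(** For the upper bound, the indicator z of the zero entries satisfies
    diag d * diag z = 0, and the rank of diag z is bounded below. *)
Lemma rank_diag_mx (F : fieldType) n (d : 'rV[F]_n) :
  \rank (diag_mx d) = #|[set i | d 0 i != 0]|.
Proof.
apply/eqP; rewrite eqn_leq leq_rank_diag_mx andbT.
pose z : 'rV[F]_n := \row_i (d 0 i == 0)%:R.
have dz : diag_mx d *m diag_mx z = 0.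
  rewrite mulmx_diag; apply/matrixP => i j; rewrite !mxE.
  by case: eqP => [->|_]; rewrite ?mul0r ?mulr0 mul0rn.
have := mulmx0_rank_max dz; have := leq_rank_diag_mx z.
have := cardC [set i | d 0 i != 0]; rewrite card_ord.
rewrite (@eq_card _ [set i | z 0 i != 0] [predC [set i | d 0 i != 0]]) => [|i].
  by move: #|_| #|_| (\rank _) (\rank _); lia.
by rewrite !inE mxE negbK; case: (d 0 i == 0); rewrite ?oner_eq0 ?eqxx.
Qed.

Section Spectral.
Variable R : rcfType.
Local Notation C := R[i].
Local Notation toC := (map_mx (real_complex R)).
Local Notation "M ^t*" := (map_mx Num.conj (trmx M)) (at level 30).

(** A real symmetric matrix is Hermitian over the complex numbers, so its
    diagonal form has real entries. *)
Lemma symmetric_diagonalization n (A : 'M[R]_n) : A^T = A ->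
  exists (P : 'M[C]_n) (d : 'rV[R]_n),
    P *m P ^t* = 1%:M /\ toC A = P ^t* *m diag_mx (toC d) *m P.
Proof.
move=> Asym; have Aherm : toC A \is hermsymmx.
  apply: realsym_hermsym.
    by apply/is_hermitianmxP; rewrite scale1r map_mx_id // map_trmx Asym.
  by apply/mxOverP => i j; rewrite mxE; apply/complex_realP; exists (A i j).
have P_unitary := spectral_unitarymx (toC A).
exists (spectralmx (toC A)), (map_mx (@complex.Re R) (spectral_diag (toC A))).
split; first exact/unitarymxP.
have -> : toC (map_mx (@complex.Re R) (spectral_diag (toC A))) = spectral_diag (toC A).
  apply/rowP => i; rewrite !mxE RRe_real //.
  exact: mxOverP (hermitian_spectral_diag_real Aherm) 0 i.
rewrite -invmx_unitary //; exact/orthomx_spectralP/hermitian_normalmx.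
Qed.

(** The min-max bound on the second eigenvalue when one null vector u is known.
    If at most one eigenvalue were at most k, then in the coordinates of an
    eigenbasis u would be supported on that single coordinate i0; so g, being
    orthogonal to u, would vanish at i0 and involve only eigenvalues above k,
    and its Rayleigh quotient would exceed k. *)
Lemma symmetric_spectrum n (A : 'M[R]_n) (k : R) (u g : 'rV[R]_n) :
  A^T = A -> 0 <= k ->
  u != 0 -> u *m A = 0 -> g != 0 -> g *m u^T = 0 ->
  (g *m A *m g^T) 0 0 <= k * (g *m g^T) 0 0 ->
  exists s : seq R, [/\ size s = n, sorted <=%R s,
    forall a, count_mem a s = \rank (eigenspace A a) & s`_1 <= k].
Proof.
move=> Asym k_ge0 u_neq0 uA g_neq0 gu g_le.
have [P [d [PP AE]]] := symmetric_diagonalization Asym.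
have PP' : P ^t* *m P = 1%:M by apply: mulmx1C.
(* The diagonal entries, sorted: by rank-nullity, the multiplicity of a among
   them is the dimension of its eigenspace. *)
pose s := sort <=%R [seq d 0 i | i <- enum 'I_n].
have s_sorted : sorted <=%R s by apply: sort_sorted; exact: le_total.
have s_size : size s = n by rewrite size_sort size_map size_enum_ord.
have s_count (a : pred R) : count a s = #|[set i | a (d 0 i)]|.
  rewrite count_sort count_map enumT cardE /enum_mem size_filter.
  by apply: eq_count => i; rewrite /= inE.
exists s; split=> // [a|].
  rewrite s_count mxrank_ker -(mxrank_map (real_complex R)).
  have -> : toC (A - a%:M) = P ^t* *m diag_mx (toC (d - const_mx a)) *m P.
    rewrite !map_mxB AE raddfB /= mulmxBr mulmxBl map_const_mx diag_const_mx map_scalar_mx.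
    by congr (_ - _); rewrite scalar_mxC -mulmxA PP' mulmx1.
  have P_unit : P \in unitmx by case: (mulmx1_unit PP).
  have Pt_unit : P ^t* \in unitmx by case: (mulmx1_unit PP).
  rewrite mxrankMfree ?row_free_unit // eqmxMfull ?row_full_unit //.
  have := cardC [set i | d 0 i == a]; rewrite card_ord rank_diag_mx => cardE.
  rewrite (@eq_card _ [set i | _ != 0] [predC [set i | d 0 i == a]]) => [|i].
    by rewrite -[X in (X - _)%N]cardE addnK.
  by rewrite !inE !mxE fmorph_eq0 subr_eq0.
rewrite leNgt; apply/negP => k_lt.
have few : (#|[set i | (d 0 i <= k)%R]| <= 1)%N.
  rewrite -(s_count (fun a => a <= k)) -(cat_take_drop 1 s) count_cat.
  rewrite [X in (_ + X)%N](_ : _ = 0%N) ?addn0.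
    by apply: leq_trans (count_size _ _) _; rewrite size_take; case: ltnP.
  apply/eqP; rewrite -leqn0 leqNgt -has_count; apply/hasPn => a a_in.
  rewrite -ltNge; apply: lt_le_trans k_lt _.
  have := index_mem a (drop 1 s); rewrite a_in size_drop ltn_subRL => lt_i.
  rewrite -(nth_index 0 a_in) nth_drop.
  apply: (sorted_leq_nth le_trans le_refl) => //; rewrite ?leq_addr //.
  exact: leq_ltn_trans (leq_addr _ _) lt_i.
(* The coordinates of v in the orthonormal eigenbasis formed by the rows of P. *)
pose co (v : 'rV[R]_n) := toC v *m P ^t*.
have co_adj v : (co v) ^t* = P *m toC v^T.
  rewrite /co trmx_mul map_mxM !map_trmx trmxK; congr (_ *m _).
    by apply/matrixP => i j; rewrite !mxE; exact: conjCK.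
  apply/matrixP => i j; rewrite !mxE.
  by apply: conj_Creal; apply/complex_realP; exists (v j i).
have co_dot v w : toC (v *m w^T) = co v *m (co w) ^t*.
  by rewrite co_adj /co mulmxA -(mulmxA (toC v)) PP' mulmx1 map_mxM.
have co_eq0 v : co v = 0 -> v = 0.
  move=> /(congr1 (mulmx^~ P)); rewrite mul0mx /co -mulmxA PP' mulmx1.
  by move/eqP; rewrite map_mx_eq0 => /eqP.
have co_quad v : toC (v *m A *m v^T) = co v *m diag_mx (toC d) *m (co v) ^t*.
  by rewrite co_adj !map_mxM AE /co !mulmxA.
have co_u i : d 0 i != 0 -> co u 0 i = 0.
  move=> d_neq0; have : co u *m diag_mx (toC d) = 0.
    have : toC (u *m A) *m P ^t* = 0 by rewrite uA map_mx0 mul0mx.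
    by rewrite map_mxM AE !mulmxA -mulmxA PP mulmx1.
  move/rowP/(_ i)/eqP; rewrite mul_mx_diag !mxE mulf_eq0 fmorph_eq0 (negPf d_neq0) orbF.
  by move/eqP.
clearbody co.
have [i0 ui0] : exists i, co u 0 i != 0.
  apply/existsP; rewrite -negb_forall; apply: contra u_neq0 => /forallP u0.
  by apply/eqP/co_eq0/rowP => i; rewrite [RHS]mxE; apply/eqP.
have u_le i : co u 0 i != 0 -> d 0 i <= k.
  by apply: contraNT; rewrite -ltNge => k_d; rewrite co_u // gt_eqF // (le_lt_trans k_ge0).
have only_i0 i : d 0 i <= k -> i = i0.
  by move=> d_le; apply: (card_le1_eqP few); rewrite inE // u_le.
have gi0 : co g 0 i0 = 0.
  have /matrixP/(_ 0 0)/eqP : co g *m (co u) ^t* = 0 by rewrite -co_dot gu map_mx0.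
  rewrite !mxE (bigD1 i0) //= big1 ?addr0 => [|i i_neq].
    by rewrite !mxE mulf_eq0 conjC_eq0 (negPf ui0) orbF => /eqP.
  rewrite !mxE; have [->|/u_le/only_i0 E] := eqVneq (co u 0 i) 0; first by rewrite conjC0 mulr0.
  by rewrite E eqxx in i_neq.
have term_ge0 i : 0 <= (d 0 i - k)%:C%C * `|co g 0 i| ^+ 2.
  have [/only_i0->|k_d] := leP (d 0 i) k; first by rewrite gi0 normr0 expr0n mulr0.
  by rewrite mulr_ge0 ?exprn_ge0 // ler0c subr_ge0 ltW.
have sum_le0 : \sum_i (d 0 i - k)%:C%C * `|co g 0 i| ^+ 2 <= 0.
  have -> : \sum_i (d 0 i - k)%:C%C * `|co g 0 i| ^+ 2
      = ((g *m A *m g^T) 0 0 - k * (g *m g^T) 0 0)%:C%C.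
    rewrite rmorphB rmorphM /=.
    have /matrixP/(_ 0 0) := co_quad g; rewrite mxE => ->.
    have /matrixP/(_ 0 0) := co_dot g g; rewrite mxE => ->.
    rewrite mul_mx_diag !mxE mulr_sumr -sumrB; apply: eq_bigr => i _.
    by rewrite !mxE normCK rmorphB /= mulrBl mulrCA mulrA.
  by rewrite -(rmorph0 (real_complex R)) lecR subr_le0.
case/negP: g_neq0; apply/eqP/co_eq0/rowP => i; rewrite [RHS]mxE.
have [/only_i0-> //|k_d] := leP (d 0 i) k.
have /eqP : \sum_i (d 0 i - k)%:C%C * `|co g 0 i| ^+ 2 = 0.
  by apply/le_anti; rewrite sum_le0 sumr_ge0.
rewrite psumr_eq0 // => /allP/(_ i (mem_index_enum i)) /=.
by rewrite mulf_eq0 fmorph_eq0 subr_eq0 gt_eqF //= expf_eq0 normr_eq0 => /eqP.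
Qed.
End Spectral.

(** * Self-adjoint operators on functions over a finite type *)

(** The vectors encoded by a basis of the row space of M form a basis. *)
Lemma dim_vsof (F : fieldType) (vT : vectType F) (e : (\dim {:vT}).-tuple vT)
    (M : 'M[F]_(\dim {:vT})) :
  basis_of {:vT} e -> \dim (vsof e M) = \rank M.
Proof.
move=> e_basis; pose B := row_base M.
pose X := [tuple vecof e (row i B) | i < \rank M].
have XE (c : 'I_(\rank M) -> F) :
    \sum_i c i *: X`_i = vecof e ((\row_i c i) *m B).
  rewrite mulmx_sum_row linear_sum; apply: eq_bigr => i _.
  by rewrite linearZ -tnth_nth tnth_mktuple mxE.
have mem_X v : (v \in <<X>>%VS) = (v \in vsof e M).
  rewrite -rVof_sub //.
  have <- : (rVof e v <= B)%MS = (rVof e v <= M)%MS by rewrite eq_row_base.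
  apply/idP/idP => [/coord_span->|/submxP[c cE]].
    by rewrite XE vecofK // submxMl.
  rewrite -[v](rVofK e_basis) cE (_ : c = \row_i c 0 i); last first.
    by apply/rowP => i; rewrite mxE.
  rewrite -XE; apply: memv_suml => i _; rewrite memvZ // memv_span // mem_nth //.
  by rewrite size_tuple.
have X_free : free X.
  apply/freeP => c; rewrite XE => /eqP; rewrite vecof_eq0 //.
  rewrite mulmx_free_eq0 ?row_base_free // => /eqP/rowP c0 i.
  by have := c0 i; rewrite !mxE.
have -> : vsof e M = <<X>>%VS by apply/vspaceP => v; rewrite mem_X.
by rewrite (eqnP X_free) size_tuple.
Qed.

Section SelfAdjoint.
Variables (R : rcfType) (I : finType).
Local Notation fT := {ffun I -> R^o}.

Definition fdot (f g : fT) : R := \sum_x f x * g x.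

Lemma dim_ffun : \dim {:fT} = #|I|.
Proof. by rewrite dimvf /dim /= muln1. Qed.

(** The matrix of a self-adjoint operator is symmetric in the basis of delta
    functions, which is orthonormal for [fdot]; this transfers
    [symmetric_spectrum] from matrices to operators on functions. *)
Lemma selfadjoint_spectrum (T : 'End(fT)) (k : R) (u g : fT) :
  (forall f h : fT, fdot (T f) h = fdot f (T h)) -> 0 <= k ->
  u != 0 -> T u = 0 -> g != 0 -> fdot g u = 0 ->
  fdot (T g) g <= k * fdot g g ->
  exists s : seq R, [/\ size s = #|I|, sorted <=%R s,
    forall a, count_mem a s = \dim (leigenspace T a) & s`_1 <= k].
Proof.
move=> T_adj k_ge0 u_neq0 Tu g_neq0 gu g_le.
pose h (i : 'I_(\dim {:fT})) : I := enum_val (cast_ord dim_ffun i).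
pose h' (x : I) : 'I_(\dim {:fT}) := cast_ord (esym dim_ffun) (enum_rank x).
have hK : cancel h h' by move=> i; rewrite /h /h' enum_valK cast_ordK.
have h'K : cancel h' h by move=> x; rewrite /h /h' cast_ordKV enum_rankK.
pose delta x : fT := [ffun y => (x == y)%:R].
pose e := [tuple delta (h i) | i < \dim {:fT}].
have eE (i : 'I_(\dim {:fT})) : e`_i = delta (h i) by rewrite -tnth_nth tnth_mktuple.
have sum_e (c : 'I_(\dim {:fT}) -> R) x : (\sum_i c i *: e`_i) x = c (h' x).
  transitivity (\sum_i c i * (h i == x)%:R).
    by rewrite sum_ffunE; apply: eq_bigr => i _; rewrite ffunE eE ffunE.
  rewrite (bigD1 (h' x)) //= big1 => [|i i_neq].
    by rewrite h'K eqxx mulr1 addr0.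
  rewrite [_ == x](_ : _ = false) ?mulr0 //.
  by apply: contraNF i_neq => /eqP <-; rewrite hK.
have e_free : free e.
  apply/freeP => c c0 i; have := sum_e c (h i).
  by rewrite c0 ffunE hK => <-.
have e_basis : basis_of {:fT} e by rewrite basisEfree e_free subvf size_tuple /=.
have coordE f i : coord e i f = f (h i).
  by rewrite {2}(coord_basis e_basis (memvf f)) sum_e hK.
have rVofE f i : rVof e f 0 i = f (h i) by rewrite [LHS]mxE coordE.
have dotE f1 f2 : fdot f1 f2 = (rVof e f1 *m (rVof e f2)^T) 0 0.
  rewrite mxE /fdot (reindex h) /=; last by exists h' => ? _.
  by apply: eq_bigr => i _; rewrite -!rVofE [X in _ = _ * X]mxE.
have rVof0 f : f != 0 -> rVof e f != 0 by rewrite rVof_eq0.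
pose A := mxof e e T.
have A_sym : A^T = A.
  apply/matrixP => i j; rewrite [LHS]mxE.
  have AE a b : A a b = fdot (T (delta (h a))) (delta (h b)).
    have -> : A a b = row a A 0 b by rewrite [RHS]mxE.
    rewrite rowE mul_mxof rVofE vecof_delta eE /fdot.
    rewrite (bigD1 (h b)) //= big1 => [|x x_neq].
      by rewrite [delta (h b) _]ffunE eqxx mulr1 addr0.
    by rewrite [delta (h b) _]ffunE eq_sym (negPf x_neq) mulr0.
  rewrite !AE T_adj /fdot; apply: eq_bigr => x _; exact: mulrC.
have uA : rVof e u *m A = 0 by rewrite -rVof_app // Tu linear0.
have gu0 : rVof e g *m (rVof e u)^T = 0.
  by apply/matrixP => i j; rewrite !ord1 -dotE gu [RHS]mxE.
have gA_le : (rVof e g *m A *m (rVof e g)^T) 0 0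
    <= k * (rVof e g *m (rVof e g)^T) 0 0.
  by rewrite -rVof_app // -!dotE.
have [s [s_size s_sorted s_count s_le]] :=
  symmetric_spectrum A_sym k_ge0 (rVof0 _ u_neq0) uA (rVof0 _ g_neq0) gu0 gA_le.
exists s; split=> // [|a]; first by rewrite s_size dim_ffun.
by rewrite s_count (leigenspaceE e_basis) dim_vsof.
Qed.
End SelfAdjoint.

(** * Dirichlet energy *)

Section Dirichlet.
Variables (R : realType) (V : finType) (e : rel V).
Hypothesis e_sym : symmetric e.
Local Notation vfun := {ffun V -> R^o}.

(** The sum runs over ordered pairs, so this is twice the usual energy. *)
Definition dirichlet (u v : vfun) : R :=
  \sum_x \sum_(y | e x y) (u x - u y) * (v x - v y).

Lemma dirichletC u v : dirichlet u v = dirichlet v u.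
Proof. by do 2!apply: eq_bigr => ? _; rewrite mulrC. Qed.

Lemma dirichlet_ge0 u : 0 <= dirichlet u u.
Proof. by do 2!apply: sumr_ge0 => ? _; rewrite -expr2 sqr_ge0. Qed.

(** Summation by parts: exchanging the names of x and y turns each summand
    v x * (u x - u y) on the right into v y * (u y - u x), and the two add up to
    the summand on the left. *)
Lemma dirichlet_green u v : dirichlet u v = 2 * \sum_x v x * laplacian e u x.
Proof.
have E : \sum_x v x * laplacian e u x = \sum_x \sum_(y | e x y) v x * (u x - u y).
  by apply: eq_bigr => x _; rewrite mulr_sumr.
have E' : \sum_x v x * laplacian e u x = \sum_x \sum_(y | e x y) v y * (u y - u x).
  rewrite E (exchange_big_dep predT) //=; apply: eq_bigr => x _.
  by apply: eq_bigl => y; rewrite e_sym.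
rewrite mulr2n mulrDl mul1r {1}E E' -big_split; apply: eq_bigr => x _ /=.
rewrite -big_split; apply: eq_bigr => y _ /=; ring.
Qed.

Lemma dirichlet_eq0 u : (forall x y, connect e x y) ->
  dirichlet u u = 0 -> forall x y, u x = u y.
Proof.
move=> e_conn u0 x y.
have term_ge0 a b : 0 <= (u a - u b) * (u a - u b) by rewrite -expr2 sqr_ge0.
have edge a b : e a b -> u a = u b.
  move=> eab; move/eqP: u0; rewrite psumr_eq0 => [|c _]; last by apply: sumr_ge0.
  move/allP/(_ a (mem_index_enum a)) => /=; rewrite psumr_eq0 // => /allP/(_ b (mem_index_enum b)).
  by rewrite eab /= mulf_eq0 orbb subr_eq0 => /eqP.
have /connectP[p p_path ->] := e_conn x y.
by elim: p x p_path => //= z p IH x /andP[/edge-> /IH].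
Qed.
End Dirichlet.

(** * The Dirichlet-to-Neumann operator *)

Section DtN.
Variables (R : realType) (V : finType) (e : rel V).
Hypotheses (e_tree : is_tree e) (V_ge3 : (3 <= #|V|)%N).
Local Notation vfun := {ffun V -> R^o}.
Local Notation bfun := {ffun bvertex e -> R^o}.
Local Notation ext := (@harmonic_extension R V e).

Let e_sym : symmetric e. Proof. by case: e_tree. Qed.
Let e_conn x y : connect e x y. Proof. by case: e_tree. Qed.

(** The linear map whose inverse solves the Dirichlet problem: it is injective
    by an energy argument, hence onto, which gives existence and uniqueness of
    harmonic extensions at once. *)
Definition dirichlet_problem (u : vfun) : vfun :=
  [ffun x => if x \in interior e then laplacian e u x else u x].

Lemma laplacian_linear (a : R) (u v : vfun) x :
  laplacian e (a *: u + v) x = a * laplacian e u x + laplacian e v x.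
Proof.
rewrite /laplacian mulr_sumr -big_split; apply: eq_bigr => y _ /=.
by rewrite !ffunE /GRing.scale /=; ring.
Qed.

Lemma dirichlet_problem_linear : linear dirichlet_problem.
Proof.
move=> a u v; apply/ffunP => x; rewrite !ffunE.
by case: ifP => _; rewrite ?laplacian_linear ?ffunE.
Qed.

(** A solution with zero data has zero energy, so it is constant, and it vanishes
    at a leaf. *)
Lemma dirichlet_problem_eq0 u : dirichlet_problem u = 0 -> u = 0.
Proof.
move=> /ffunP u0; have {}u0 x : if x \in interior e then laplacian e u x = 0 else u x = 0.
  by have := u0 x; rewrite !ffunE; case: ifP.
have /card_gt0P[b b_leaf] : (0 < #|boundary e|)%N.
  exact: leq_trans (boundary_ge2 e_tree V_ge3).
have D0 : dirichlet e u u = 0.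
  rewrite dirichlet_green // big1 ?mulr0 // => x _.
  by have := u0 x; case: ifP => _ ->; rewrite ?mulr0 ?mul0r.
apply/ffunP => x; rewrite (dirichlet_eq0 e_conn D0 x b) ffunE.
by have := u0 b; rewrite inE b_leaf.
Qed.

Lemma exists_harmonic_extension (f : bfun) :
  exists u, is_harmonic_extension f u.
Proof.
pose H := GRing.isLinear.Build _ _ _ _ dirichlet_problem dirichlet_problem_linear.
pose L : {linear vfun -> vfun} := HB.pack dirichlet_problem H.
have L_ker : lker (linfun L) == 0%VS.
  apply/lker0P => u v; rewrite !lfunE /= => uv.
  apply/eqP; rewrite -subr_eq0; apply/eqP/dirichlet_problem_eq0.
  by have := linearB L u v; rewrite /= uv subrr.
pose w : vfun := [ffun x => if insub x is Some b then f b else 0].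
have /lker0_limgf w_im := L_ker.
have : w \in limg (linfun L) by rewrite w_im memvf.
case/memv_imgP => u _; rewrite lfunE /= => /ffunP wE; exists u; split=> [x x_int|b].
  have := wE x; rewrite !ffunE x_int insubF ?inE; first by move=> <-.
  by move: x_int; rewrite !inE => /negbTE.
have := wE (val b); rewrite !ffunE valK inE (valP b) /= => ->.
by [].
Qed.

Lemma harmonic_extensionP (f : bfun) : is_harmonic_extension f (ext f).
Proof.
rewrite /harmonic_extension; apply: classical_sets.xgetPex.
exact: exists_harmonic_extension.
Qed.

Lemma harmonic_extension_uniq (f : bfun) u : is_harmonic_extension f u -> u = ext f.
Proof.
move=> [u_harm u_bd]; have [w_harm w_bd] := harmonic_extensionP f.
apply/eqP; rewrite -subr_eq0; apply/eqP/dirichlet_problem_eq0/ffunP => x.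
rewrite -[u - _]addrC -scaleN1r ffunE [RHS]ffunE.
case: ifPn => [x_int|]; first by rewrite laplacian_linear u_harm // w_harm // mulr0 addr0.
rewrite in_setC negbK => x_leaf.
have xE : val (Sub x x_leaf : bvertex e) = x by [].
by rewrite !ffunE -xE u_bd w_bd /GRing.scale /= mulN1r addNr.
Qed.

Lemma harmonic_extension_linear : linear ext.
Proof.
move=> a f g; apply/esym/harmonic_extension_uniq.
have [f_harm f_bd] := harmonic_extensionP f; have [g_harm g_bd] := harmonic_extensionP g.
split=> [x x_int|b]; first by rewrite laplacian_linear f_harm // g_harm // mulr0 addr0.
by rewrite !ffunE f_bd g_bd.
Qed.

(** No two leaves are adjacent, so the normal derivative at a leaf involves all of
    its neighbours. *)
Lemma normal_derivativeE (u : vfun) x : x \in boundary e ->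
  normal_derivative e u x = laplacian e u x.
Proof.
move=> x_leaf; apply: eq_bigl => y; apply: andb_idl.
exact: leaf_neighbour_interior.
Qed.

(** [linfun] agrees with the function it is given only when that function is
    linear, here because harmonic extension is. *)
Lemma DtNE (f : bfun) b : DtN R e f b = laplacian e (ext f) (val b).
Proof.
have DtN_linear : linear (@DtN_fun R V e).
  move=> a g h; apply/ffunP => x; rewrite !ffunE !normal_derivativeE ?(valP x) //.
  by rewrite harmonic_extension_linear laplacian_linear.
pose H := GRing.isLinear.Build _ _ _ _ _ DtN_linear.
pose L : {linear bfun -> bfun} := HB.pack (@DtN_fun R V e) H.
by rewrite (lfunE L) /= ffunE normal_derivativeE ?(valP b).
Qed.

(** In the summation by parts only the leaves contribute, whatever the interior
    values of v. Taking for v a harmonic extension gives self-adjointness,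
    taking any other v gives the minimality of the energy. *)
Lemma fdot_DtN (f : bfun) (v : vfun) (g : bfun) : (forall b, v (val b) = g b) ->
  2 * fdot (DtN R e f) g = dirichlet e (ext f) v.
Proof.
move=> v_bd; rewrite dirichlet_green //; congr (_ * _); rewrite /fdot.
rewrite [RHS](bigID (mem (boundary e))) /= [X in _ = _ + X]big1 ?addr0; last first.
  move=> x x_int; have [-> //] := harmonic_extensionP f; first by rewrite mulr0.
  by rewrite inE.
rewrite [RHS]big_sub; apply: eq_bigr => b _ /=.
by rewrite DtNE v_bd mulrC.
Qed.

Lemma DtN_selfadjoint (f g : bfun) : fdot (DtN R e f) g = fdot f (DtN R e g).
Proof.
have fdotC (h k : bfun) : fdot h k = fdot k h.
  by rewrite /fdot; apply: eq_bigr => b _; rewrite mulrC.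
apply: (@mulfI _ 2); first by rewrite pnatr_eq0.
rewrite (fdotC f) (fdot_DtN f (v := ext g)) => [|b]; last by case: (harmonic_extensionP g).
rewrite (fdot_DtN g (v := ext f)) => [|b]; last by case: (harmonic_extensionP f).
exact: dirichletC.
Qed.

Lemma DtN_const (c : R) : DtN R e [ffun=> c] = 0.
Proof.
have /harmonic_extension_uniq extE :
    is_harmonic_extension ([ffun=> c] : bfun) ([ffun=> c] : vfun).
  split=> [x _|b]; last by rewrite !ffunE.
  by rewrite /laplacian big1 // => y _; rewrite !ffunE subrr.
apply/ffunP => b; rewrite DtNE -extE [RHS]ffunE.
by rewrite /laplacian big1 // => y _; rewrite !ffunE subrr.
Qed.

(** Dirichlet's principle: v - ext f vanishes at the leaves and is therefore
    orthogonal to ext f for the energy form, so that the energy of v is the sum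
    of those of ext f and v - ext f. *)
Lemma DtN_energy_le (f : bfun) (v : vfun) : (forall b, v (val b) = f b) ->
  2 * fdot (DtN R e f) f <= dirichlet e v v.
Proof.
move=> v_bd; have E := fdot_DtN f v_bd.
have E' : 2 * fdot (DtN R e f) f = dirichlet e (ext f) (ext f).
  by apply: fdot_DtN; case: (harmonic_extensionP f).
have := dirichlet_ge0 e (v - ext f).
have -> : dirichlet e (v - ext f) (v - ext f) =
    dirichlet e v v - 2 * dirichlet e (ext f) v + dirichlet e (ext f) (ext f).
  rewrite /dirichlet mulr_sumr -sumrB -big_split; apply: eq_bigr => x _ /=.
  rewrite mulr_sumr -sumrB -big_split; apply: eq_bigr => y _ /=.
  by rewrite !ffunE; ring.
by rewrite -E -E'; lra.
Qed.

(** Only the edge xy contributes, once for each of its orientations. *)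
Lemma dirichlet_side x y (b c : R) : e x y ->
  let v : vfun := [ffun w => b * (w \in side e x y)%:R - c] in
  dirichlet e v v = 2 * b ^+ 2.
Proof.
move=> exy v; pose s : vfun := [ffun w => (w \in side e x y)%:R].
have vE u w : v u - v w = b * (s u - s w) by rewrite !ffunE; ring.
have -> : dirichlet e v v = b * dirichlet e v s.
  rewrite /dirichlet mulr_sumr; apply: eq_bigr => u _; rewrite mulr_sumr.
  by apply: eq_bigr => w _; rewrite (vE u w); ring.
have y_in := mem_side e x y; have x_out := notin_side e_tree exy.
rewrite dirichlet_green //; suff -> : \sum_u s u * laplacian e v u = b by ring.
rewrite (bigD1 y) //= [s y]ffunE y_in mul1r big1 => [|u u_neq].
  rewrite addr0 /laplacian (bigD1 x) /=; last by rewrite e_sym.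
  rewrite vE [s y]ffunE [s x]ffunE y_in (negPf x_out) subr0 mulr1.
  rewrite big1 ?addr0 // => w /andP[eyw w_neq]; rewrite vE !ffunE y_in.
  have [w_in|w_out] := boolP (w \in _); first by rewrite subrr mulr0.
  by case: (side_exit e_tree exy eyw y_in w_out) w_neq => _ ->; rewrite eqxx.
rewrite ffunE; have [u_in|_] := boolP (u \in _); last by rewrite mul0r.
rewrite mul1r /laplacian big1 // => w euw.
rewrite vE !ffunE u_in; have [w_in|w_out] := boolP (w \in _); first by rewrite subrr mulr0.
by case: (side_exit e_tree exy euw u_in w_out) u_neq => ->; rewrite eqxx.
Qed.

(** The test function is b times the indicator of one side, shifted by - a to
    have sum zero over the leaves. *)
Lemma spectrum_edge_bound x y (k : R) : e x y -> 0 <= k ->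
  (0 < #|leaves e x y| < #|boundary e|)%N ->
  #|boundary e|%:R <= k * (#|leaves e x y|%:R * (#|boundary e|%:R - #|leaves e x y|%:R)) ->
  exists s : seq R, steklov_spectrum e s /\ s`_1 <= k.
Proof.
set a := #|leaves e x y|; set b := #|boundary e| => exy k_ge0 /andP[a_gt0 a_lt] k_le.
pose v : vfun := [ffun w => b%:R * (w \in side e x y)%:R - a%:R].
pose g : bfun := [ffun c => v (val c)].
have card_bd : #|{: bvertex e}| = b by rewrite card_sig.
(* g takes the value b - a on a leaves and the value - a on the b - a others. *)
have sum_g (F : R -> R) :
    \sum_c F (g c) = a%:R * F (b%:R - a%:R) + (b%:R - a%:R) * F (- a%:R).
  transitivity (\sum_(w in boundary e) F (v w)).
    by rewrite [RHS]big_sub; apply: eq_bigr => c _; rewrite ffunE.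
  rewrite (bigID (mem (side e x y))) /=; congr (_ + _).
    rewrite (eq_bigr (fun=> F (b%:R - a%:R))) => [|w /andP[_ w_in]]; last first.
      by rewrite ffunE w_in mulr1.
    rewrite big_const iter_addr addr0 mulr_natl; congr (_ *+ _).
    by apply: eq_card => w; rewrite [LHS]unfold_in in_setI andbC.
  rewrite (eq_bigr (fun=> F (- a%:R))) => [|w /andP[_ w_out]]; last first.
    by rewrite ffunE (negPf w_out) mulr0 add0r.
  rewrite big_const iter_addr addr0 -[X in _ = X * _](natrB _ (ltnW a_lt)) mulr_natl; congr (_ *+ _).
  have := cardsID (side e x y) (boundary e); rewrite setIC -/(leaves e x y) -/a -/b => <-.
  by rewrite addKn; apply: eq_card => w; rewrite [LHS]unfold_in in_setD andbC.
have gg : fdot g g = b%:R * (a%:R * (b%:R - a%:R)).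
  by rewrite /fdot (sum_g (fun t => t * t)); ring.
have a_gt0' : 0 < a%:R :> R by rewrite ltr0n.
have b_gt_a : 0 < b%:R - a%:R :> R by rewrite subr_gt0 ltr_nat.
have b_gt0 : 0 < b%:R :> R by rewrite ltr0n (leq_trans _ a_lt).
have g_neq0 : g != 0.
  apply/eqP => g0; move: gg; rewrite /fdot big1 => [E|c _]; last by rewrite g0 ffunE mul0r.
  by have := mulr_gt0 b_gt0 (mulr_gt0 a_gt0' b_gt_a); rewrite -E ltxx.
have one_neq0 : ([ffun=> 1] : bfun) != 0.
  have /card_gt0P[c _] : (0 < #|{: bvertex e}|)%N by rewrite card_bd (leq_trans _ a_lt).
  by apply/eqP => /ffunP/(_ c)/eqP; rewrite !ffunE oner_eq0.
have g1 : fdot g [ffun=> 1] = 0.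
  rewrite /fdot (eq_bigr (fun c => g c)) => [|c _]; last by rewrite [X in _ * X]ffunE mulr1.
  by rewrite (sum_g id); ring.
have g_le : fdot (DtN R e g) g <= k * fdot g g.
  have : 2 * fdot (DtN R e g) g <= 2 * b%:R ^+ 2.
    rewrite -(dirichlet_side b%:R a%:R exy); apply: DtN_energy_le => c.
    by rewrite [RHS]ffunE.
  rewrite ler_pM2l // => /le_trans; apply.
  by rewrite gg mulrCA expr2 ler_pM2l.
have [s [s_size s_sorted s_count s_le]] :=
  selfadjoint_spectrum DtN_selfadjoint k_ge0 one_neq0 (DtN_const 1) g_neq0 g1 g_le.
by exists s; split=> //; split=> //; rewrite s_size card_bd.
Qed.

End DtN.

(** * The bound on the second eigenvalue *)

Unset Implicit Arguments.

Theorem theorem1p1 (R : realType) (V : finType) (e : rel V) (D : nat)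
    (e_tree : is_tree e) (V_ge3 : (3 <= #|V|)%N)
    (D_gt0 : (0 < D)%N) (deg_le : forall x : V, (degree e x <= D)%N) :
  exists lambda : seq R,
    steklov_spectrum e lambda /\
    lambda`_1 <= 4 * (D%:R - 1) / #|boundary e|%:R.
Proof.
have [x [y [exy small large]]] := exists_balanced_edge e_tree V_ge3 deg_le.
have b_ge2 := boundary_ge2 e_tree V_ge3.
have D_ge2 : (2 <= D)%N.
  have [z z_int] := exists_interior e_tree V_ge3.
  exact: leq_trans (interior_degree e_tree V_ge3 z_int) (deg_le z).
have D_ge2R : 2 <= D%:R :> R by rewrite ler_nat.
apply: (spectrum_edge_bound e_tree V_ge3 exy).
- by rewrite mulr_ge0 ?invr_ge0 // mulr_ge0 //; lra.
- apply/andP; split; last by lia.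
  by rewrite lt0n; apply: contraTneq large => ->; lia.
move: small large; rewrite -(ler_nat R) -[(_ <= D * _)%N](ler_nat R) !natrM.
set a := #|leaves e x y|%:R; set b := #|boundary e|%:R => small large.
have b_gt0 : 0 < b by rewrite ltr0n; lia.
have a_ge0 : 0 <= a by exact: ler0n.
rewrite -(ler_pM2l b_gt0) mulrA [b * (_ / _)]mulrC divfK ?gt_eqF //.
have half : b <= 2 * (b - a) by lra.
have share : b <= 2 * (D%:R - 1) * a by nra.
have -> : 4 * (D%:R - 1) * (a * (b - a)) = (2 * (D%:R - 1) * a) * (2 * (b - a)) by ring.
by apply: ler_pM => //; exact: ltW.
Qed.
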